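(* Let $T$ and $A$ be bounded linear operators on a complex Hilbert space $H\neq\{0\}$, and suppose that $0$ does not belong to the approximate point spectrum of $A$. Then $$[M_T(A)]^{2}=\sup\left\{\, g(T^{*}T)-\frac{|g(A^{*}T)|^{2}}{g(A^{*}A)} \;:\; g \text{ is a state on } B(H,H) \text{ and } g(A^{*}A)\neq 0\right\}.$$
   Context: $(\cdot,\cdot)$ is the inner product of $H$ (linear in the first variable) and $\|\cdot\|$ its norm. $B(H,H)$ is the Banach algebra of all bounded linear operators on $H$. A state on $B(H,H)$ is a normalized positive linear functional, i.e. a linear functional $g:B(H,H)\to\mathbb{C}$ with $g(I)=1=\|g\|$. The condition that $0$ is not in the approximate point spectrum of $A$ means that there is $c>0$ with $\|Ax\|\ge c\|x\|$ for all $x\in H$. Under this condition the translatable radius of $T$ in the direction of $A$ is $$M_T(A)=\sup_{\|f\|=1}\left\|Tf-\frac{(Tf,Af)}{(Af,Af)}Af\right\|=\sup_{\|f\|=1}\left\{\|Tf\|^{2}-\frac{|(Tf,Af)|^{2}}{(Af,Af)}\right\}^{1/2}.$$ *)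

(* Defs.v *)
From HB Require Import structures.
From mathcomp Require Import all_boot all_order all_algebra.
From mathcomp Require Import all_classical all_reals all_analysis.
From mathcomp Require Import complex.

Set Implicit Arguments.
Unset Strict Implicit.
Unset Printing Implicit Defensive.

Import Order.TTheory GRing.Theory Num.Theory Num.Def.
Import numFieldNormedType.Exports.

Local Open Scope classical_set_scope.
Local Open Scope ring_scope.
Local Open Scope complex_scope.

(* The form is linear in the first variable and conjugate-linear in the
   second. *)
Record hilbertType (R : realType) := Hilbert {
  hilbert_sort :> completeNormedModType R[i] ;
  inner : {dot hilbert_sort for conjC} ;
  inner_norm : forall x : hilbert_sort, inner x x = `|x| ^+ 2 }.

Arguments inner {R h}.

(* On a normed space over R[i] the library norm takes its values in R[i];
   rnorm is the same norm with values in R. *)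
Definition rnorm (R : realType) (V : normedZmodType R[i]) (x : V) : R :=
  complex.Re `|x|.

Lemma rnormE (R : realType) (V : normedZmodType R[i]) (x : V) :
  (rnorm x)%:C = `|x|.
Proof. by rewrite /rnorm RRe_real ?normr_real. Qed.

Section BoundedOperators.
Variables (R : realType) (H : hilbertType R).

Definition bounded_linear : {pred H -> H} := fun f =>
  `[< linear f /\ exists M : R, forall x, rnorm (f x) <= M * rnorm x >].

Lemma bounded_linearP (f : H -> H) : reflect
  (linear f /\ exists M : R, forall x, rnorm (f x) <= M * rnorm x)
  (f \in bounded_linear).
Proof. exact: asboolP. Qed.

Lemma ler_rnormD (x y : H) : rnorm (x + y) <= rnorm x + rnorm y.
Proof. by rewrite -lecR rmorphD /= !rnormE ler_normD. Qed.

Lemma rnorm_ge0 (x : H) : 0 <= rnorm x.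
Proof. by rewrite -ler0c rnormE. Qed.

Lemma rnormZ (k : R[i]) (x : H) : rnorm (k *: x) = rnorm k * rnorm x.
Proof. by apply: complexI; rewrite rmorphM /= !rnormE normrZ. Qed.

Lemma bounded_linear_submod : submod_closed bounded_linear.
Proof.
split=> [|k f g /bounded_linearP[lf [M fM]] /bounded_linearP[lg [N gN]]].
  apply/bounded_linearP; split=> [a x y|]; first by rewrite /= scaler0 addr0.
  by exists 0 => x; rewrite mul0r /rnorm [X in `|X|](_ : _ = 0) // normr0.
apply/bounded_linearP; split=> [a x y|].
  rewrite [LHS](_ : _ = k *: f (a *: x + y) + g (a *: x + y)) //.
  rewrite [in RHS](_ : (k *: f + g) x = k *: f x + g x) //.
  rewrite [in RHS](_ : (k *: f + g) y = k *: f y + g y) //.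
  by rewrite lf lg !scalerDr !scalerA (mulrC a) addrACA.
exists (rnorm k * M + N) => x.
rewrite [X in rnorm X](_ : _ = k *: f x + g x) //.
apply: le_trans (ler_rnormD _ _) _; rewrite mulrDl lerD //.
by rewrite rnormZ -mulrA ler_wpM2l // -ler0c rnormE.
Qed.

HB.instance Definition _ :=
  GRing.isSubmodClosed.Build _ _ bounded_linear bounded_linear_submod.

Record bop := Bop { bop_fun :> H -> H ; bopP : bop_fun \in bounded_linear }.

HB.instance Definition _ := [isSub of bop for bop_fun].
HB.instance Definition _ := [Choice of bop by <:].
HB.instance Definition _ := [SubChoice_isSubLmodule of bop by <:].

Lemma bop_id_subproof : (idfun : H -> H) \in bounded_linear.
Proof.
by apply/bounded_linearP; split=> //; exists 1 => x; rewrite mul1r.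
Qed.

Lemma bop_comp_subproof (S T : bop) : (S \o T : H -> H) \in bounded_linear.
Proof.
have /bounded_linearP[lf [M fM]] := bopP S.
have /bounded_linearP[lg [N gN]] := bopP T.
apply/bounded_linearP; split=> [a x y|] /=; first by rewrite lg lf.
exists (`|M| * N) => x /=; apply: le_trans (fM _) _.
apply: (@le_trans _ _ (`|M| * rnorm (T x))).
  by rewrite ler_wpM2r ?rnorm_ge0 // ler_norm.
by rewrite -mulrA ler_wpM2l.
Qed.

Definition bop_id : bop := Bop bop_id_subproof.
Definition bop_comp (S T : bop) : bop := Bop (bop_comp_subproof S T).

Fact bop_linear (S : bop) : linear S.
Proof. by have /bounded_linearP[] := bopP S. Qed.

Fact bop_compA : associative bop_comp.
Proof. by move=> S T U; apply: val_inj. Qed.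
Fact bop_comp1 : left_id bop_id bop_comp.
Proof. by move=> S; apply: val_inj. Qed.
Fact bop_compr1 : right_id bop_id bop_comp.
Proof. by move=> S; apply: val_inj. Qed.
Fact bop_compDl : left_distributive bop_comp +%R.
Proof. by move=> S T U; apply: val_inj. Qed.
Fact bop_compDr : right_distributive bop_comp +%R.
Proof.
move=> S T U; apply: val_inj; apply/funext => x /=.
have := bop_linear S 1 (T x) (U x); by rewrite !scale1r.
Qed.

(* The product of bop H is composition. *)
HB.instance Definition _ := GRing.Zmodule_isPzRing.Build bop
  bop_compA bop_comp1 bop_compr1 bop_compDl bop_compDr.

(* The bounded operator S with (Tx, y) = (x, Sy) for all x and y; it exists
   by Riesz representation, so the default value 0 is never used. *)
Definition adjoint (T : bop) : bop :=
  xget 0 [set S : bop | forall x y, inner (T x) y = inner x (S y)].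

Definition opnorm (S : bop) : R :=
  sup [set rnorm (S x) | x in [set x : H | rnorm x <= 1]].

(* Norm of a linear functional on the bounded operators, +oo when the
   functional is unbounded. *)
Definition functional_norm (g : bop -> R[i]) : \bar R :=
  ereal_sup [set (rnorm (g S))%:E | S in [set S : bop | opnorm S <= 1]].

Definition is_state (g : {scalar bop}) : Prop :=
  g 1 = 1 /\ functional_norm g = 1%E.

Definition approx_point_spectrum (A : bop) : set R[i] :=
  [set l | ~ exists2 c : R, 0 < c &
      forall x : H, c * rnorm x <= rnorm (A x - l *: x)].

Definition translatable_radius (T A : bop) : R :=
  sup [set rnorm (T f - (inner (T f) (A f) / inner (A f) (A f)) *: A f)
      | f in [set f : H | rnorm f = 1]].

End BoundedOperators.

(* Main.v *)
Require Import Defs.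
From HB Require Import structures.
From mathcomp Require Import all_boot all_order all_algebra.
From mathcomp Require Import all_classical all_reals all_analysis.
From mathcomp Require Import complex ring lra.

Set Implicit Arguments.
Unset Strict Implicit.
Unset Printing Implicit Defensive.

Import Order.TTheory GRing.Theory Num.Theory.
Import numFieldNormedType.Exports.
Local Open Scope classical_set_scope.
Local Open Scope ring_scope.
Local Open Scope complex_scope.

(* For a state g put a = g(A*A) > 0, lam = g(A*T) / a and T' = T - lam A.  The
   value attached to g is rho = g(T*T) - a |lam|^2, and it is unchanged, as is
   the residual of Tf along Af, when T is replaced by T'; so one may assume
   g(A*T) = 0.  The set of triples (Re (T'f, Af), Im (T'f, Af), r) with
   ||f|| = 1 and r <= ||T'f||^2 is convex: a positive semidefinite operator of
   rank 2 can be moved, with its trace and two further real linear functionals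
   fixed and a third one not decreasing, to one of rank 1, since Hermitian
   2 x 2 matrices form a 4-dimensional real space.  If (0, 0, rho) were at
   positive distance from this set, a separating hyperplane would give a bounded
   operator S with Re (Sf, f) bounded below on the unit sphere by more than
   Re g(S), which is impossible for a state.  Hence rho is approximated by
   ||T'f||^2 with (T'f, Af) near 0, so rho <= M_T(A)^2.  Vector states give the
   other inequality. *)

(** * Hermitian quadratic forms and reduction to rank one *)

Lemma nonzero_left_kernel (F : fieldType) (m n : nat) (M : 'M[F]_(m, n)) :
  (n < m)%N -> exists2 x : 'rV[F]_m, x != 0 & x *m M = 0.
Proof.
move=> nm; have /rowV0Pn[x xM x0] : kermx M != 0.
  by rewrite kermx_eq0 /row_free neq_ltn (leq_ltn_trans (rank_leq_col M)).
by exists x => //; apply/sub_kermxP.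
Qed.

Section HermitianQuadratic.
Variables (R : realType) (V : lmodType R[i]).

(** For Q(x) = B(x, x) with B Hermitian and linear in the first variable, [X] and [Y] are twice the
    real and imaginary parts of B(u, v). The coefficient of [u] is taken real because a common phase
    does not change Q. *)
Definition hermitian_quadratic (Q : V -> R) : Prop :=
  forall u v, exists X Y : R, forall a c d : R,
    Q (a%:C *: u + (c +i* d) *: v) =
    a ^+ 2 * Q u + (c ^+ 2 + d ^+ 2) * Q v + a * c * X + a * d * Y.

Lemma hermitian_quadraticZ (Q : V -> R) (k : R[i]) v :
  hermitian_quadratic Q ->
  Q (k *: v) = (complex.Re k ^+ 2 + complex.Im k ^+ 2) * Q v.
Proof.
move=> /(_ v v)[X [Y Q_E]]; case: k => c d.
by have := Q_E 0 c d; rewrite scale0r add0r => -> /=; ring.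
Qed.

(* [rho = u u* + v v*] is moved along a Hermitian direction [(p, q, w1 + i w2)] of
   the span of u and v that is killed by N, Q1 and Q2, until it has rank 1.  N
   being definite, that direction has negative determinant [- D] unless u and v
   are collinear. *)
Lemma hermitian_sum_rank1 (N Q1 Q2 Q3 : V -> R) :
  hermitian_quadratic N -> hermitian_quadratic Q1 ->
  hermitian_quadratic Q2 -> hermitian_quadratic Q3 ->
  (forall x, 0 <= N x) -> (forall x, N x = 0 -> x = 0) ->
  forall u v, exists h, [/\ N h = N u + N v, Q1 h = Q1 u + Q1 v,
    Q2 h = Q2 u + Q2 v & Q3 u + Q3 v <= Q3 h].
Proof.
move=> hN h1 h2 h3 N_ge0 N_eq0 u v.
(* On a complex line every form is a multiple of the squared modulus of the coordinate, so [z]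
   scaled by the square root of |k|^2 + |l|^2 realises all four sums exactly. *)
have collinear z (k l : R[i]) : u = k *: z -> v = l *: z ->
    exists h, [/\ N h = N u + N v, Q1 h = Q1 u + Q1 v,
    Q2 h = Q2 u + Q2 v & Q3 u + Q3 v <= Q3 h].
  move=> -> ->.
  pose s := complex.Re k ^+ 2 + complex.Im k ^+ 2
    + (complex.Re l ^+ 2 + complex.Im l ^+ 2).
  have s_ge0 : 0 <= s by rewrite !addr_ge0 ?sqr_ge0.
  exists ((Num.sqrt s)%:C *: z).
  rewrite !hermitian_quadraticZ //= !sqr_sqrtr // !expr0n /= !addr0 -!mulrDl.
  by split.
have [X0 [Y0 NE]] := hN u v; have [X1 [Y1 Q1E]] := h1 u v.
have [X2 [Y2 Q2E]] := h2 u v; have [X3 [Y3 Q3E]] := h3 u v.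
(* [L] pairs a form with the Hermitian matrix W of diagonal [p], [q] and off-diagonal entry w =
   [w1 +i* w2]. Three homogeneous equations in four real unknowns leave a nonzero W, whose sign is
   then chosen to suit [Q3]. *)
pose L Qu Qv X Y (p q w1 w2 : R) := p * Qu + q * Qv + w1 * X + w2 * Y.
have [p [q [w1 [w2 [nz L0 L1 L2 L3]]]]] : exists p q w1 w2 : R,
    [/\ [|| p != 0, q != 0, w1 != 0 | w2 != 0],
     L (N u) (N v) X0 Y0 p q w1 w2 = 0,
     L (Q1 u) (Q1 v) X1 Y1 p q w1 w2 = 0,
     L (Q2 u) (Q2 v) X2 Y2 p q w1 w2 = 0 &
     0 <= L (Q3 u) (Q3 v) X3 Y3 p q w1 w2].
  pose e0 : 'I_4 := inord 0; pose e1 : 'I_4 := inord 1.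
  pose e2 : 'I_4 := inord 2; pose e3 : 'I_4 := inord 3.
  have I4 (i : 'I_4) : [\/ i = e0, i = e1, i = e2 | i = e3].
    by case: i => [[|[|[|[|]]]] i4] //;
      [apply: Or41|apply: Or42|apply: Or43|apply: Or44];
      apply: val_inj; rewrite /= inordK.
  pose M : 'M[R]_(4, 3) := \matrix_(i, j)
    nth 0 (nth [::] [:: [:: N u; N v; X0; Y0]; [:: Q1 u; Q1 v; X1; Y1];
                        [:: Q2 u; Q2 v; X2; Y2]] j) i.
  have [x x_neq0 xM] := nonzero_left_kernel M isT.
  have xL Qu Qv X Y j : nth [::] [:: [:: N u; N v; X0; Y0];
      [:: Q1 u; Q1 v; X1; Y1]; [:: Q2 u; Q2 v; X2; Y2]] j = [:: Qu; Qv; X; Y] ->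
      (j < 3)%N -> L Qu Qv X Y (x 0 e0) (x 0 e1) (x 0 e2) (x 0 e3) = 0.
    move=> jE j3; have := congr1 (fun A : 'rV_3 => A 0 (Ordinal j3)) xM.
    rewrite !mxE => <-; rewrite /L !big_ord_recl big_ord0 !mxE addr0 !addrA.
    have ne (i : 'I_4) k (k4 : (k < 4)%N) : i = k :> nat -> inord k = i.
      by move=> ik; apply: val_inj; rewrite /= inordK // ik.
    rewrite /e0 /e1 /e2 /e3.
    rewrite (ne ord0 0%N) // (ne (lift ord0 ord0) 1%N) //.
    rewrite (ne (lift ord0 (lift ord0 ord0)) 2%N) //.
    rewrite (ne (lift ord0 (lift ord0 (lift ord0 ord0))) 3%N) //.
    by rewrite /= jE.
  have nz : [|| x 0 e0 != 0, x 0 e1 != 0, x 0 e2 != 0 | x 0 e3 != 0].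
    apply: contraNT x_neq0; rewrite !negb_or !negbK.
    move=> /and4P[/eqP? /eqP? /eqP? /eqP?].
    by apply/eqP/rowP => i; rewrite mxE; case: (I4 i) => ->.
  have [ge0|lt0] :=
      leP 0 (L (Q3 u) (Q3 v) X3 Y3 (x 0 e0) (x 0 e1) (x 0 e2) (x 0 e3)).
    exists (x 0 e0), (x 0 e1), (x 0 e2), (x 0 e3); split=> //.
    - exact: (xL _ _ _ _ 0%N).
    - exact: (xL _ _ _ _ 1%N).
    - exact: (xL _ _ _ _ 2%N).
  have LN Qu Qv X Y a b c d :
      L Qu Qv X Y (- a) (- b) (- c) (- d) = - L Qu Qv X Y a b c d.
    by rewrite /L; ring.
  exists (- x 0 e0), (- x 0 e1), (- x 0 e2), (- x 0 e3).
  rewrite !oppr_eq0 !LN; split=> //.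
  - by rewrite (xL _ _ _ _ 0%N) ?oppr0.
  - by rewrite (xL _ _ _ _ 1%N) ?oppr0.
  - by rewrite (xL _ _ _ _ 2%N) ?oppr0.
  - by rewrite oppr_ge0 ltW.
pose D := w1 ^+ 2 + w2 ^+ 2 - p * q.
(* If D <= 0, the value of [N] at p u + w v is [D * N v] <= 0, so this vector vanishes and u, v are
   collinear. When p = 0, w vanishes too, so q N(v) = 0 with q nonzero, and v = 0. *)
have [D_le0|D_gt0] := leP D 0.
  have [p0|p_neq0] := eqVneq p 0.
    have w1_0 : w1 = 0 by move: D_le0; rewrite /D p0; nra.
    have w2_0 : w2 = 0 by move: D_le0; rewrite /D p0; nra.
    move: nz L0; rewrite /L p0 w1_0 w2_0 eqxx !mul0r /= orbF add0r !addr0.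
    move=> q_neq0 /eqP; rewrite mulf_eq0 (negPf q_neq0) /= => /eqP /N_eq0 v0.
    by apply: (collinear u 1 0); rewrite ?scale1r ?scale0r.
  have Npuwv : N (p%:C *: u + (w1 +i* w2) *: v) = D * N v.
    rewrite NE /D; move: L0; rewrite /L => L0.
    rewrite [RHS](_ : _ = p * (p * N u + q * N v + w1 * X0 + w2 * Y0) + D * N v).
      by rewrite /D; ring.
    by rewrite L0 mulr0 add0r.
  have /N_eq0/eqP : N (p%:C *: u + (w1 +i* w2) *: v) = 0.
    by apply/eqP; rewrite eq_le N_ge0 Npuwv andbT mulr_le0_ge0.
  rewrite addr_eq0 => /eqP puwv.
  apply: (collinear v (- (p%:C^-1 * (w1 +i* w2))) 1); last by rewrite scale1r.
  rewrite scaleNr -scalerA -scalerN -puwv scalerA mulVf ?scale1r //.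
  by apply: contra p_neq0 => /eqP[->].
(* [s] below is the positive root of det(1 + s W) = 1 + s tau - s^2 D. *)
pose tau := p + q; pose r := Num.sqrt (tau ^+ 2 + 4 * D).
have r2 : r ^+ 2 = tau ^+ 2 + 4 * D.
  by rewrite sqr_sqrtr // addr_ge0 ?sqr_ge0 // mulr_ge0 // ltW.
have r_ge0 : 0 <= r by exact: sqrtr_ge0.
have r_gt : 0 < tau + r.
  by have [|] := leP 0 tau; nra.
pose s := (tau + r) / (2 * D).
have s_gt0 : 0 < s by rewrite divr_gt0 // mulr_gt0.
have sD : s ^+ 2 * D = 1 + s * tau.
  have s2D : s * (2 * D) = tau + r.
    by rewrite /s divfK // mulf_neq0 ?pnatr_eq0 ?gt_eqF.
  have : (s * (2 * D) - tau) ^+ 2 = r ^+ 2 by rewrite s2D; ring.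
  rewrite r2 => E.
  have : 4 * D * (s ^+ 2 * D - (1 + s * tau)) = 0 by move: E; lra.
  move/eqP; rewrite !mulf_eq0 pnatr_eq0 (gt_eqF D_gt0) /=.
  by rewrite subr_eq0 => /eqP.
move: (s) s_gt0 sD => {}s {}s_gt0 {}sD.
(* The diagonal entries of 1 + s W. Its determinant is zero and its trace is 1 + s^2 D > 0, so it is
   positive semidefinite of rank 1: the outer product of a vector [(al, c +i* d)] with itself. *)
pose a2 := 1 + s * p; pose b2 := 1 + s * q.
have ab : a2 * b2 = s ^+ 2 * (w1 ^+ 2 + w2 ^+ 2).
  by move: sD; rewrite /a2 /b2 /tau /D; lra.
have ab_ge0 : 0 <= a2 * b2 by rewrite ab mulr_ge0 ?addr_ge0 ?sqr_ge0.
have aDb : 0 < a2 + b2.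
  have := mulr_gt0 (mulr_gt0 s_gt0 s_gt0) D_gt0; move: sD.
  by rewrite /a2 /b2 /tau; lra.
have a2_ge0 : 0 <= a2 by nra.
have b2_ge0 : 0 <= b2 by nra.
have [al [c [d [alE cdE cE dE]]]] : exists al c d : R,
    [/\ al ^+ 2 = a2, c ^+ 2 + d ^+ 2 = b2, al * c = s * w1 & al * d = s * w2].
  have [a0|a_neq0] := eqVneq a2 0.
    exists 0, (Num.sqrt b2), 0; rewrite sqr_sqrtr // !expr0n /= !mul0r addr0.
    move: ab; rewrite a0 mul0r => /esym/eqP; rewrite mulf_eq0 expf_eq0 /= gt_eqF //=.
    rewrite paddr_eq0 ?sqr_ge0 // !sqrf_eq0 => /andP[/eqP-> /eqP->].
    by rewrite mulr0.
  have sa : 0 < Num.sqrt a2 by rewrite sqrtr_gt0 lt_def a_neq0.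
  exists (Num.sqrt a2), (s * w1 / Num.sqrt a2), (s * w2 / Num.sqrt a2).
  rewrite sqr_sqrtr //; split => //; try by field; rewrite (gt_eqF sa).
  rewrite !exprMn !exprVn sqr_sqrtr // -mulrDl -mulrDr -ab.
  by rewrite mulrAC mulfV // mul1r.
have hE Q X Y : (forall a c d : R, Q (a%:C *: u + (c +i* d) *: v) =
    a ^+ 2 * Q u + (c ^+ 2 + d ^+ 2) * Q v + a * c * X + a * d * Y) ->
    Q (al%:C *: u + (c +i* d) *: v) = Q u + Q v + s * L (Q u) (Q v) X Y p q w1 w2.
  by move=> ->; rewrite alE cdE cE dE /a2 /b2 /L; ring.
exists (al%:C *: u + (c +i* d) *: v).
rewrite (hE _ _ _ NE) (hE _ _ _ Q1E) (hE _ _ _ Q2E) (hE _ _ _ Q3E) L0 L1 L2.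
by rewrite mulr0 !addr0 lerDl mulr_ge0 // ltW.
Qed.

End HermitianQuadratic.

Section Separation.
Variables (R : realType) (V : lmodType R[i]).

(* The squared distance F from (g1, g2, g3) to the convex set of triples
   (Q1 x, Q2 x, r) with N x = 1, r <= Q3 x is nearly minimised at f; moving from f
   towards any other unit vector x by a small step t gives the separating
   functional. *)
Lemma unit_vector_approx (N Q1 Q2 Q3 : V -> R) (K g1 g2 g3 : R) :
  hermitian_quadratic N -> hermitian_quadratic Q1 ->
  hermitian_quadratic Q2 -> hermitian_quadratic Q3 ->
  (forall x, 0 <= N x) -> (forall x, N x = 0 -> x = 0) ->
  (exists x, N x = 1) ->
  (forall x, N x = 1 -> [/\ `|Q1 x| <= K, `|Q2 x| <= K & `|Q3 x| <= K]) ->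
  (forall a1 a2 a3 delta : R,
    (forall x, N x = 1 -> delta <= a1 * Q1 x + a2 * Q2 x + a3 * Q3 x) ->
    delta <= a1 * g1 + a2 * g2 + a3 * g3) ->
  forall e : R, 0 < e -> exists x,
    [/\ N x = 1, `|Q1 x - g1| <= e, `|Q2 x - g2| <= e & g3 - e <= Q3 x].
Proof.
move=> hN h1 h2 h3 N_ge0 N_eq0 [x0 Nx0] bQ g_supp e e_gt0.
(* The convex set is a hypograph in its third coordinate, so only a shortfall below [g3] counts as
   distance. *)
pose pos x := Num.max 0 (g3 - Q3 x).
pose F x := (Q1 x - g1) ^+ 2 + (Q2 x - g2) ^+ 2 + pos x ^+ 2.
pose S := [set F x | x in [set x | N x = 1]].
have F_ge0 x : 0 <= F x by rewrite !addr_ge0 ?sqr_ge0.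
have S_inf : has_inf S.
  by split; [exists (F x0), x0|exists 0 => _ [x _ <-]].
have inf_le x : N x = 1 -> inf S <= F x.
  by move=> Nx; apply: (ge_inf S_inf.2); exists x.
have [inf_le0|d0_gt0] := leP (inf S) 0.
  have e2 : inf S < e ^+ 2 by rewrite (le_lt_trans inf_le0) ?exprn_gt0.
  have [_ [x Nx <-] Fx] := inf_lt S_inf.1 e2.
  have [p_ge0 p_ge] : 0 <= pos x /\ g3 - Q3 x <= pos x.
    by rewrite /pos !le_max !lexx ?orbT.
  have sq := sqr_ge0.
  have le_sqr (y : R) : y ^+ 2 <= e ^+ 2 -> `|y| <= e.
    by rewrite -[y ^+ 2]real_normK ?num_real // ler_pXn2r ?nnegrE // ltW.
  exists x; move: Fx; rewrite /F => Fx; split=> //.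
  - by apply: le_sqr; have := sq _ (Q2 x - g2); have := sq _ (pos x); lra.
  - by apply: le_sqr; have := sq _ (Q1 x - g1); have := sq _ (pos x); lra.
  - have : `|pos x| <= e.
      by apply: le_sqr; have := sq _ (Q1 x - g1); have := sq _ (Q2 x - g2); lra.
    by rewrite ger0_norm //; lra.
pose d0 := inf S.
(* [C] bounds the squared distance between the point of the convex set attached to [f] and that of
   [x] (see [gap]); the final 1 makes it positive. *)
pose C := (K + K) ^+ 2 + (K + K) ^+ 2 + (`|g3| + K + (`|g3| + K)) ^+ 2 + 1.
have C_gt0 : 0 < C by rewrite ltr_wpDl // !addr_ge0 ?sqr_ge0.
have [t /andP[t_gt0 t_le1] tC] : exists2 t : R, 0 < t <= 1 & t * C <= d0 / 2.
  have z : 0 < d0 / 2 / C by rewrite !divr_gt0.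
  exists (Num.min 1 (d0 / 2 / C)); first by rewrite lt_min ltr01 z ge_min lexx.
  by rewrite -ler_pdivlMr // ge_min lexx orbT.
have [_ [f Nf <-] Ff] : exists2 y, S y & y < d0 + t * d0 / 2.
  by apply: inf_adherent => //; rewrite divr_gt0 // mulr_gt0.
(* Let P be the right-hand side and h the unit vector replacing the convex combination of f and x.
   Then d0 <= F(h) <= (1 - 2t) F(f) + 2t P + t^2 C, and the choices of [t] and [f] leave P >= d0 /
   2. *)
have supp x : N x = 1 -> d0 / 2 <= (Q1 f - g1) * (Q1 x - g1)
    + (Q2 f - g2) * (Q2 x - g2) + pos f * (g3 - Q3 x).
  move=> Nx.
  have rt : 0 <= 1 - t by rewrite subr_ge0.
  have [h [Nh Q1h Q2h Q3h]] := hermitian_sum_rank1 hN h1 h2 h3 N_ge0 N_eq0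
    ((Num.sqrt (1 - t))%:C *: f) ((Num.sqrt t)%:C *: x).
  move: Nh Q1h Q2h Q3h; rewrite !hermitian_quadraticZ //= !expr0n /= !addr0.
  rewrite !sqr_sqrtr ?(ltW t_gt0) // Nf Nx => Nh Q1h Q2h Q3h.
  have {}Nh : N h = 1 by rewrite Nh; ring.
  have posf : g3 - Q3 f <= pos f by rewrite /pos le_max lexx orbT.
  pose y := g3 - Q3 x.
  have pos_h : pos h ^+ 2 <= ((1 - t) * pos f + t * y) ^+ 2.
    have [le0|gt0] := leP (g3 - Q3 h) 0.
      by rewrite /pos (max_idPl le0) expr0n sqr_ge0.
    have le : g3 - Q3 h <= (1 - t) * pos f + t * y.
      have := ler_wpM2l rt posf; rewrite /y; lra.
    rewrite /pos (max_idPr (ltW gt0)) ler_pXn2r // nnegrE ?ltW //.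
    exact: lt_le_trans gt0 le.
  have d0F := inf_le h Nh; rewrite -/d0 in d0F.
  have Fh : F h <= (1 - t) ^+ 2 * F f + 2 * t * (1 - t) *
      ((Q1 f - g1) * (Q1 x - g1) + (Q2 f - g2) * (Q2 x - g2) + pos f * y)
      + t ^+ 2 * ((Q1 x - g1) ^+ 2 + (Q2 x - g2) ^+ 2 + y ^+ 2).
    rewrite {1}/F Q1h Q2h; move: pos_h; rewrite /F; lra.
  have gap : (Q1 f - Q1 x) ^+ 2 + (Q2 f - Q2 x) ^+ 2 + (pos f - y) ^+ 2 <= C.
    have [a1 a2 a3] := bQ f Nf; have [b1 b2 b3] := bQ x Nx.
    have sq_le (z M : R) : `|z| <= M -> z ^+ 2 <= M ^+ 2.
      move=> zM; rewrite -real_normK ?num_real // ler_pXn2r ?nnegrE //.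
      exact: le_trans zM.
    have l1 : (Q1 f - Q1 x) ^+ 2 <= (K + K) ^+ 2.
      by apply: sq_le; rewrite (le_trans (ler_normB _ _)) // lerD.
    have l2 : (Q2 f - Q2 x) ^+ 2 <= (K + K) ^+ 2.
      by apply: sq_le; rewrite (le_trans (ler_normB _ _)) // lerD.
    have l3 : (pos f - y) ^+ 2 <= (`|g3| + K + (`|g3| + K)) ^+ 2.
      have n3 z : N z = 1 -> `|g3 - Q3 z| <= `|g3| + K.
        by case/bQ => _ _ ?; rewrite (le_trans (ler_normB _ _)) // lerD2l.
      apply: sq_le; rewrite (le_trans (ler_normB _ _)) // lerD ?n3 //.
      have gK : 0 <= `|g3| + K by rewrite (le_trans _ (n3 f Nf)).
      have [le0|/ltW ge0] := leP (g3 - Q3 f) 0.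
        by rewrite /pos (max_idPl le0) normr0.
      by rewrite /pos (max_idPr ge0) n3.
    by rewrite /C; lra.
  rewrite -/y; set P := (X in _ <= X); rewrite -/P in Fh.
  have := ler_wpM2l (sqr_ge0 t) gap.
  have FP : F f - 2 * P + ((Q1 x - g1) ^+ 2 + (Q2 x - g2) ^+ 2 + y ^+ 2) =
      (Q1 f - Q1 x) ^+ 2 + (Q2 f - Q2 x) ^+ 2 + (pos f - y) ^+ 2.
    by rewrite /F /P; ring.
  rewrite -FP => gap2.
  have tC2 := ler_wpM2l (ltW t_gt0) tC.
  have tF : t * d0 <= t * F f by rewrite ler_pM2l // inf_le.
  rewrite -(ler_pM2l t_gt0).
  by lra.
(* Evaluated at (g1, g2, g3) itself, the separating functional would give d0 / 2 <= 0. *)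
have := g_supp (Q1 f - g1) (Q2 f - g2) (- pos f)
  (d0 / 2 + (Q1 f - g1) * g1 + (Q2 f - g2) * g2 - pos f * g3).
have prem x : N x = 1 -> d0 / 2 + (Q1 f - g1) * g1 + (Q2 f - g2) * g2 - pos f * g3
    <= (Q1 f - g1) * Q1 x + (Q2 f - g2) * Q2 x + - pos f * Q3 x.
  by move=> /supp; lra.
by move=> /(_ prem); have := d0_gt0; rewrite -/d0; lra.
Qed.

End Separation.

(** * Real and imaginary parts of complex numbers *)

Section ComplexParts.
Variable R : realType.
Implicit Types a b : R[i].

Lemma complexReD a b : complex.Re (a + b) = complex.Re a + complex.Re b.
Proof. by case: a b => ? ? [? ?]. Qed.

Lemma complexImD a b : complex.Im (a + b) = complex.Im a + complex.Im b.
Proof. by case: a b => ? ? [? ?]. Qed.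

Lemma complexReM a b : complex.Re (a * b) =
  complex.Re a * complex.Re b - complex.Im a * complex.Im b.
Proof. by case: a b => ? ? [? ?]. Qed.

Lemma complexImM a b : complex.Im (a * b) =
  complex.Re a * complex.Im b + complex.Im a * complex.Re b.
Proof. by case: a b => ? ? [? ?]. Qed.

Lemma sqr_rnorm_complex a : rnorm a ^+ 2 = complex.Re a ^+ 2 + complex.Im a ^+ 2.
Proof. by rewrite /rnorm normc_def sqr_sqrtr // addr_ge0 ?sqr_ge0. Qed.

End ComplexParts.

(** * Real and imaginary parts of the inner product; Cauchy-Schwarz *)

Section HilbertSpace.
Variables (R : realType) (H : hilbertType R).
Implicit Types (x y z : H) (k : R[i]).

Definition rinner x y : R := complex.Re (inner x y).
Definition iinner x y : R := complex.Im (inner x y).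

Lemma innerC x y : inner y x = (inner x y)^*%C.
Proof. by rewrite hermC expr0 mul1r. Qed.

Lemma innerZl k x y : inner (k *: x) y = k * inner x y.
Proof. exact: linearZl_LR. Qed.

Lemma rinnerC x y : rinner y x = rinner x y.
Proof. by rewrite /rinner innerC; case: (inner x y). Qed.

Lemma iinnerC x y : iinner y x = - iinner x y.
Proof. by rewrite /iinner innerC; case: (inner x y). Qed.

Lemma rinnerDl x y z : rinner (x + y) z = rinner x z + rinner y z.
Proof. by rewrite /rinner linearDl complexReD. Qed.

Lemma iinnerDl x y z : iinner (x + y) z = iinner x z + iinner y z.
Proof. by rewrite /iinner linearDl complexImD. Qed.

Lemma rinnerZl k x y :
  rinner (k *: x) y = complex.Re k * rinner x y - complex.Im k * iinner x y.
Proof. by rewrite /rinner /iinner innerZl complexReM. Qed.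

Lemma iinnerZl k x y :
  iinner (k *: x) y = complex.Re k * iinner x y + complex.Im k * rinner x y.
Proof. by rewrite /rinner /iinner innerZl complexImM. Qed.

Lemma rinnerDr x y z : rinner x (y + z) = rinner x y + rinner x z.
Proof. by rewrite !(rinnerC _ x) rinnerDl. Qed.

Lemma iinnerDr x y z : iinner x (y + z) = iinner x y + iinner x z.
Proof. by rewrite !(iinnerC _ x) iinnerDl opprD. Qed.

Lemma rinnerZr k x y :
  rinner x (k *: y) = complex.Re k * rinner x y + complex.Im k * iinner x y.
Proof. by rewrite !(rinnerC _ x) rinnerZl (iinnerC x y) mulrN opprK. Qed.

Lemma iinnerZr k x y :
  iinner x (k *: y) = complex.Re k * iinner x y - complex.Im k * rinner x y.
Proof.
by rewrite -[LHS]opprK -iinnerC iinnerZl (iinnerC x y) (rinnerC x y); ring.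
Qed.

Lemma rinnerNl x y : rinner (- x) y = - rinner x y.
Proof. by rewrite -scaleN1r rinnerZl /=; ring. Qed.

Lemma rinnerNr x y : rinner x (- y) = - rinner x y.
Proof. by rewrite rinnerC rinnerNl rinnerC. Qed.

Lemma iinnerNl x y : iinner (- x) y = - iinner x y.
Proof. by rewrite -scaleN1r iinnerZl /=; ring. Qed.

Lemma iinnerNr x y : iinner x (- y) = - iinner x y.
Proof. by rewrite iinnerC iinnerNl -iinnerC. Qed.

Definition innerE := (rinnerDl, rinnerDr, iinnerDl, iinnerDr,
  rinnerNl, rinnerNr, iinnerNl, iinnerNr,
  rinnerZl, rinnerZr, iinnerZl, iinnerZr).

Lemma rinnerxx x : rinner x x = rnorm x ^+ 2.
Proof. by rewrite /rinner inner_norm -rnormE -rmorphXn. Qed.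

Lemma iinnerxx x : iinner x x = 0.
Proof. by have := iinnerC x x; lra. Qed.

Lemma rnorm_eq0 x : rnorm x = 0 -> x = 0.
Proof. by move=> x0; apply/eqP; rewrite -normr_eq0 -rnormE x0. Qed.

Lemma bopD (S : bop H) x y : S (x + y) = S x + S y.
Proof. by have := bop_linear S 1 x y; rewrite !scale1r. Qed.

Lemma bop0 (S : bop H) : S 0 = 0.
Proof. by apply: (addIr (S 0)); rewrite -bopD !add0r. Qed.

Lemma bopZ (S : bop H) k x : S (k *: x) = k *: S x.
Proof. by have := bop_linear S k x 0; rewrite bop0 !addr0. Qed.

Lemma hermitian_quadratic_rinner (S T : bop H) :
  hermitian_quadratic (fun x => rinner (S x) (T x)).
Proof.
move=> u v; exists (rinner (S u) (T v) + rinner (S v) (T u)).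
exists (iinner (S u) (T v) - iinner (S v) (T u)) => a c d.
by rewrite !bopD !bopZ !innerE /=; ring.
Qed.

(** The underlying Hermitian form is that of (T^*S - S^*T) / 2i. *)
Lemma hermitian_quadratic_iinner (S T : bop H) :
  hermitian_quadratic (fun x => iinner (S x) (T x)).
Proof.
move=> u v; exists (iinner (S u) (T v) + iinner (S v) (T u)).
exists (rinner (S v) (T u) - rinner (S u) (T v)) => a c d.
by rewrite !bopD !bopZ !innerE /=; ring.
Qed.

(** The squared triangle inequality, expanded: the norm is part of the given structure, so its
    subadditivity is available first. *)
Lemma rinner_le x y : rinner x y <= rnorm x * rnorm y.
Proof.
have := ler_rnormD x y.
rewrite -(@ler_pXn2r _ 2) ?nnegrE ?addr_ge0 ?rnorm_ge0 // -rinnerxx.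
by rewrite !innerE !rinnerxx (rinnerC x y); lra.
Qed.

Lemma rnormN x : rnorm (- x) = rnorm x.
Proof. by rewrite /rnorm normrN. Qed.

Lemma ler_norm_rinner x y : `|rinner x y| <= rnorm x * rnorm y.
Proof.
by rewrite ler_norml rinner_le andbT lerNl -rinnerNl -(rnormN x) rinner_le.
Qed.

Lemma ler_norm_iinner x y : `|iinner x y| <= rnorm x * rnorm y.
Proof.
have -> : iinner x y = rinner x ('i *: y) by rewrite rinnerZr /=; ring.
rewrite (le_trans (ler_norm_rinner _ _)) // rnormZ.
rewrite [rnorm 'i](_ : _ = 1) ?mul1r //.
by rewrite /rnorm normc_def /= expr0n /= add0r expr1n sqrtr1.
Qed.

Lemma bop_bounded (S : bop H) :
  exists2 M : R, 0 <= M & forall x, rnorm (S x) <= M * rnorm x.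
Proof.
have /bounded_linearP[_ [M SM]] := bopP S.
exists `|M| => // x; rewrite (le_trans (SM x)) // ler_wpM2r ?rnorm_ge0 //.
exact: ler_norm.
Qed.

Lemma eq_inner x y : (forall z, rinner z x = rinner z y) -> x = y.
Proof.
move=> xy; apply/eqP; rewrite -subr_eq0; apply/eqP/rnorm_eq0/eqP.
by rewrite -sqrf_eq0 -rinnerxx rinnerDr rinnerNr xy subrr eqxx.
Qed.

Lemma inner_eq x y z t :
  rinner x y = rinner z t -> iinner x y = iinner z t -> inner x y = inner z t.
Proof.
by rewrite /rinner /iinner; case: (inner x y) (inner z t) => ? ? [? ?] /= -> ->.
Qed.

End HilbertSpace.

(** * Completeness, Riesz representation and adjoints *)

Section Riesz.
Variables (R : realType) (H : hilbertType R).
Implicit Types (x y z : H).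

(** Positive radii in [R[i]] are real, so completeness in terms of filters yields this sequential
    form with radii in [R]. *)
Lemma rnorm_complete (u : nat -> H) :
  (forall e : R, 0 < e -> exists N, forall m n, (N <= m)%N -> (N <= n)%N ->
    rnorm (u m - u n) < e) ->
  exists y, forall e : R, 0 < e -> exists N, forall n, (N <= n)%N ->
    rnorm (u n - y) < e.
Proof.
move=> u_cauchy.
have cu : cvg (u @ \oo).
  apply/cauchy_cvgP/cauchy_exP => eps eps_gt0.
  have [e eE] : exists e : R, eps = e%:C.
    by apply/complex_realP; rewrite gtr0_real.
  rewrite eE ltcR in eps_gt0.
  have [N uN] := u_cauchy e eps_gt0; exists (u N); exists N => //= n Nn.
  by rewrite -ball_normE /= eE -rnormE ltcR uN.
exists (lim (u @ \oo)) => e e_gt0.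
have /cvgrPdist_lt/(_ e%:C) := cu; rewrite ltcR => /(_ e_gt0)[N _ uN].
by exists N => n Nn; rewrite -ltcR rnormE distrC uN.
Qed.

(* The representing vector is the limit of a sequence minimising
   [||x||^2 - 2 psi x], Cauchy by the parallelogram identity. *)
Lemma riesz (psi : H -> R) (K : R) :
  (forall x y, psi (x + y) = psi x + psi y) ->
  (forall (a : R) x, psi (a%:C *: x) = a * psi x) ->
  (forall x, psi x <= K * rnorm x) ->
  exists y, forall x, psi x = rinner x y.
Proof.
move=> psiD psiZ psi_le.
pose J x := rinner x x - 2 * psi x.
pose S := [set J x | x in [set: H]].
have S_inf : has_inf S.
  split; first by exists (J 0), 0.
  exists (- K ^+ 2) => _ [x _ <-]; rewrite /J rinnerxx.
  by have := psi_le x; have := sqr_ge0 (rnorm x - K); lra.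
have J_ge x : inf S <= J x by apply: (ge_inf S_inf.2); exists x.
have approx n : exists x, J x < inf S + n.+1%:R^-1.
  have n_gt0 : 0 < n.+1%:R^-1 :> R by rewrite invr_gt0 ltr0n.
  by have [_ [x _ <-] ?] := inf_adherent n_gt0 S_inf; exists x.
have [u uJ] := choice approx.
have JD x z (t : R) : J (x + t%:C *: z) =
    J x + 2 * t * (rinner x z - psi z) + t ^+ 2 * rinner z z.
  by rewrite /J !innerE /= psiD psiZ (rinnerC x z); ring.
have para x z : rnorm (x - z) ^+ 2 <= 2 * (J x - inf S) + 2 * (J z - inf S).
  have := J_ge (2^-1%:C *: (x + z)).
  have -> : J (2^-1%:C *: (x + z)) = 2^-1 * (J x + J z) - 4^-1 * rnorm (x - z) ^+ 2.
    rewrite -rinnerxx /J psiZ psiD !(innerE, iinnerxx) /=.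
    by rewrite (rinnerC x z); field.
  lra.
have inv_small (e : R) : 0 < e -> exists N, forall n, (N <= n)%N -> n.+1%:R^-1 < e.
  move=> e_gt0; exists (Num.bound e^-1) => n Nn.
  rewrite invf_plt ?posrE //.
  rewrite (lt_le_trans (archi_boundP _)) ?invr_ge0 ?(ltW e_gt0) //.
  by rewrite ler_nat leqW.
have [y uy] : exists y, forall e : R, 0 < e -> exists N, forall n, (N <= n)%N ->
    rnorm (u n - y) < e.
  apply: rnorm_complete => e e_gt0.
  have e4 : 0 < e ^+ 2 / 4 by rewrite divr_gt0 ?exprn_gt0.
  have [N Nn] := inv_small _ e4; exists N => m n /Nn mN /Nn nN.
  rewrite -(@ltr_pXn2r _ 2) ?nnegrE ?rnorm_ge0 ?(ltW e_gt0) //.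
  have um : J (u m) < inf S + e ^+ 2 / 4 by rewrite (lt_trans (uJ m)) // ltrD2l.
  have un : J (u n) < inf S + e ^+ 2 / 4 by rewrite (lt_trans (uJ n)) // ltrD2l.
  by have := para (u m) (u n); lra.
exists y => x.
(* Since [u n] minimises [J] up to e^2, the quadratic polynomial [Jt] in t is nonnegative; t = e and
   t = - e bound its linear coefficient. *)
have bound e : 0 < e -> `|rinner y x - psi x| <= e * (1 + rnorm x + rnorm x ^+ 2).
  move=> e_gt0; have e2 : 0 < e ^+ 2 by rewrite exprn_gt0.
  have [N1 hN1] := inv_small _ e2; have [N2 hN2] := uy _ e_gt0.
  pose n := maxn N1 N2.
  have n1 := hN1 n (leq_maxl _ _); have n2 := hN2 n (leq_maxr _ _).
  have Jt t : 0 <= e ^+ 2 + 2 * t * (rinner (u n) x - psi x) + t ^+ 2 * rnorm x ^+ 2.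
    have un : J (u n) < inf S + e ^+ 2 by rewrite (lt_trans (uJ n)) // ltrD2l.
    by have := J_ge (u n + t%:C *: x); rewrite JD rinnerxx; lra.
  have a1 : `|rinner (u n) x - psi x| <= e * (1 + rnorm x ^+ 2).
    have := Jt e; have := Jt (- e); rewrite sqrrN => h1 h2.
    have x2 := mulr_ge0 (ltW e2) (sqr_ge0 (rnorm x)).
    by rewrite ler_norml; apply/andP; split; rewrite -(ler_pM2l e_gt0); lra.
  have a2 : `|rinner (u n - y) x| <= e * rnorm x.
    by rewrite (le_trans (ler_norm_rinner _ _)) // ler_wpM2r ?rnorm_ge0 // ltW.
  have -> : rinner y x - psi x = (rinner (u n) x - psi x) - rinner (u n - y) x.
    by rewrite rinnerDl rinnerNl; ring.
  by rewrite (le_trans (ler_normB _ _)) //; lra.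
apply/eqP; rewrite eq_sym rinnerC -subr_eq0 -normr_le0.
apply/ler_addgt0Pr => e e_gt0; rewrite add0r.
pose C := 1 + rnorm x + rnorm x ^+ 2.
have C_gt0 : 0 < C.
  by rewrite /C -addrA ltr_pwDl // addr_ge0 ?rnorm_ge0 ?sqr_ge0.
by have := bound (e / C); rewrite -/C divfK ?gt_eqF //; apply; rewrite divr_gt0.
Qed.

(** Existence follows from [riesz] applied to the real part of (T x, z) as a function of x; [xget]
    therefore never returns its default. *)
Lemma adjointE (T : bop H) x y : inner (T x) y = inner x (adjoint T y).
Proof.
suff [S SE] : exists S : bop H, forall x y, inner (T x) y = inner x (S y).
  by rewrite /adjoint; case: xgetP => [S' _ ->//|/(_ S)]; exact.
have [M M_ge0 TM] := bop_bounded T.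
have riesz_ex z : exists s, forall x, rinner (T x) z = rinner x s.
  apply: (@riesz _ (M * rnorm z)) => [a b|a b|a].
  - by rewrite bopD rinnerDl.
  - by rewrite bopZ rinnerZl /=; ring.
  - rewrite (le_trans (rinner_le _ _)) // mulrAC ler_wpM2r ?rnorm_ge0 //.
have [S SE] := choice riesz_ex.
(* The imaginary part follows from the real one on replacing a by i a. *)
have S_adj a b : inner (T a) b = inner a (S b).
  apply: inner_eq; first exact: SE.
  have iE (c d : H) : iinner c d = - rinner ('i *: c) d by rewrite rinnerZl /=; ring.
  by rewrite !iE -bopZ SE.
have S_bl : S \in @bounded_linear R H.
  apply/bounded_linearP; split.
    move=> k a b; apply: eq_inner => z.
    have iSE c d : iinner c (S d) = iinner (T c) d by rewrite /iinner S_adj.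
    by rewrite -SE !innerE -!SE iSE.
  exists M => a; have [->|Sa] := eqVneq (rnorm (S a)) 0.
    by rewrite mulr_ge0 ?rnorm_ge0.
  have Sa_gt0 : 0 < rnorm (S a) by rewrite lt_def Sa rnorm_ge0.
  rewrite -(ler_pM2l Sa_gt0) -expr2 -rinnerxx -SE (le_trans (rinner_le _ _)) //.
  by rewrite mulrA [_ * M]mulrC ler_wpM2r ?rnorm_ge0.
by exists (Bop S_bl).
Qed.

Lemma inner_adjointM (S T : bop H) x :
  inner ((adjoint S * T) x) x = inner (T x) (S x).
Proof. by rewrite innerC -adjointE [LHS]/= -innerC. Qed.

End Riesz.

(** * States and vector states *)

Section States.
Variables (R : realType) (H : hilbertType R).
Implicit Types (x y : H) (S : bop H).

(** Multiplying [x] by the conjugate of the inner product makes the latter real, which reduces to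
    [rinner_le]. *)
Lemma rnorm_inner_le x y : rnorm (inner x y) <= rnorm x * rnorm y.
Proof.
have [->|w0] := eqVneq (rnorm (inner x y)) 0; first by rewrite mulr_ge0 ?rnorm_ge0.
have w_gt0 : 0 < rnorm (inner x y) by rewrite lt_def w0 -ler0c rnormE /=.
rewrite -(ler_pM2l w_gt0) -expr2 sqr_rnorm_complex.
have -> : complex.Re (inner x y) ^+ 2 + complex.Im (inner x y) ^+ 2 =
    rinner ((inner x y)^*%C *: x) y.
  by rewrite rinnerZl /rinner /iinner; case: (inner x y) => ? ? /=; ring.
rewrite (le_trans (rinner_le _ _)) // rnormZ mulrA.
by rewrite [rnorm _^*%C](_ : _ = rnorm (inner x y)) // /rnorm normcJ.
Qed.

Lemma rnorm_le_opnorm S x : rnorm x <= 1 -> rnorm (S x) <= opnorm S.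
Proof.
move=> x1; apply: ub_le_sup; last by exists x.
have [M M_ge0 SM] := bop_bounded S; exists M => _ [y /= y1 <-].
by rewrite (le_trans (SM y)) // ler_piMr.
Qed.

Lemma opnorm_le S (K : R) :
  (forall x, rnorm x <= 1 -> rnorm (S x) <= K) -> opnorm S <= K.
Proof.
move=> SK; apply: ge_sup => [|_ [x /= x1 <-]]; last exact: SK.
by exists (rnorm (S 0)), 0; rewrite //= /rnorm normr0 ler01.
Qed.

Lemma state_norm_le (g : {scalar bop H}) S (K : R) : is_state g -> 0 < K ->
  (forall x, rnorm x <= 1 -> rnorm (S x) <= K) -> rnorm (g S) <= K.
Proof.
move=> [_ g1] K_gt0 SK.
have rK : rnorm (K^-1)%:C = K^-1 by rewrite /rnorm ger0_norm // ler0c invr_ge0 ltW.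
have S1 : opnorm ((K^-1)%:C *: S) <= 1.
  apply: opnorm_le => x x1; rewrite [X in rnorm X](_ : _ = (K^-1)%:C *: S x) //.
  by rewrite rnormZ rK mulrC ler_pdivrMr // mul1r SK.
have : ((rnorm (g ((K^-1)%:C *: S)))%:E <= functional_norm g)%E.
  by apply: ereal_sup_ubound; exists ((K^-1)%:C *: S).
rewrite g1 lee_fin linearZ /=.
have -> : rnorm ((K^-1)%:C * g S) = K^-1 * rnorm (g S).
  apply: complexI; rewrite rmorphM /= !rnormE normrM; congr (_ * _).
  by rewrite ger0_norm // ler0c invr_ge0 ltW.
by rewrite mulrC ler_pdivrMr // mul1r.
Qed.

(* From [|g (1 - t S)| <= ||1 - t S|| <= 1 - t delta + O(t^2)] as t -> 0+. *)
Lemma state_lower_bound (g : {scalar bop H}) S (delta : R) :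
  (exists x : H, rnorm x = 1) -> is_state g ->
  (forall x, rnorm x = 1 -> delta <= rinner (S x) x) ->
  delta <= complex.Re (g S).
Proof.
move=> [x0 x0_1] gst S_ge.
have {}S_ge x : delta * rnorm x ^+ 2 <= rinner (S x) x.
  have [x_0|x_neq0] := eqVneq (rnorm x) 0.
    by rewrite x_0 (rnorm_eq0 x_0) bop0 expr0n mulr0 /rinner linear0l.
  have x_gt0 : 0 < rnorm x by rewrite lt_def x_neq0 rnorm_ge0.
  have r1 : rnorm ((rnorm x)^-1%:C *: x) = 1.
    by rewrite rnormZ /rnorm ger0_norm ?ler0c ?invr_ge0 ?rnorm_ge0 //= mulVf.
  have := S_ge _ r1; rewrite bopZ !innerE /= => le.
  rewrite -ler_pdivlMr ?exprn_gt0 // (le_trans le) // le_eqVlt; apply/orP; left.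
  by apply/eqP; field.
have [M M_ge0 SM] := bop_bounded S.
have bound t : 0 < t -> delta <= complex.Re (g S) + t * (M ^+ 2 / 2).
  (* [K] is the second-order expansion of the square root of 1 - 2 t delta + t^2 M^2; [K ^+ 2]
     exceeds this number by a square. *)
  move=> t_gt0; pose K := 1 - t * delta + t ^+ 2 * (M ^+ 2 / 2).
  have TxK x : rnorm ((1 - t%:C *: S) x) ^+ 2 <=
      (1 - 2 * t * delta + t ^+ 2 * M ^+ 2) * rnorm x ^+ 2.
    rewrite [X in rnorm X](_ : _ = x - t%:C *: S x) // -rinnerxx.
    rewrite !innerE /= !rinnerxx (rinnerC (S x)).
    have Sx : rnorm (S x) ^+ 2 <= M ^+ 2 * rnorm x ^+ 2.
      rewrite -exprMn ler_pXn2r ?nnegrE ?rnorm_ge0 ?SM //.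
      by rewrite mulr_ge0 ?rnorm_ge0.
    have := ler_wpM2l (sqr_ge0 t) Sx; have := ler_wpM2l (ltW t_gt0) (S_ge x).
    by rewrite rinnerC; lra.
  have K2 : 1 - 2 * t * delta + t ^+ 2 * M ^+ 2 <= K ^+ 2.
    by have := sqr_ge0 (t ^+ 2 * (M ^+ 2 / 2) - t * delta); rewrite /K; lra.
  (* At the unit vector [x0] the bound [TxK] shows 1 - 2 t delta + t^2 M^2 >= 0, hence K >= 1/2. *)
  have K_gt0 : 0 < K.
    have := le_trans (sqr_ge0 _) (TxK x0); rewrite x0_1 expr1n mulr1 /K; lra.
  have : rnorm (g (1 - t%:C *: S)) <= K.
    apply: state_norm_le => // x x1.
    rewrite -(@ler_pXn2r _ 2) ?nnegrE ?rnorm_ge0 ?(ltW K_gt0) //.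
    rewrite (le_trans (TxK x)) // (le_trans (ler_wpM2r _ K2)) ?sqr_ge0 //.
    by rewrite ler_piMr ?sqr_ge0 // expr_le1 ?rnorm_ge0.
  have Re_le (z : R[i]) : complex.Re z <= rnorm z.
    by rewrite (le_trans (ler_norm _)) // -lecR rnormE normc_ge_Re.
  move/(le_trans (Re_le _)); rewrite linearB linearZ /= gst.1.
  have -> : complex.Re (1 - t%:C * g S) = 1 - t * complex.Re (g S).
    by case: (g S) => a b /=; ring.
  by rewrite /K => le; rewrite -(ler_pM2l t_gt0); lra.
apply/ler_addgt0Pr => e e_gt0.
have c_gt0 : 0 < M ^+ 2 / 2 + 1 by rewrite ltr_wpDl // divr_ge0 ?sqr_ge0.
have t_gt0 : 0 < e / (M ^+ 2 / 2 + 1) by rewrite divr_gt0.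
rewrite (le_trans (bound _ t_gt0)) // lerD2l mulrAC ler_pdivrMr //.
by rewrite ler_pM2l // lerDl.
Qed.

(** [state_lower_bound] with bound 0 applies to both i S and - i S. *)
Lemma state_real (g : {scalar bop H}) S :
  (exists x : H, rnorm x = 1) -> is_state g ->
  (forall x, iinner (S x) x = 0) -> complex.Im (g S) = 0.
Proof.
move=> x0 gst S_real.
have iS k : complex.Re k = 0 -> complex.Im k * complex.Im (g S) <= 0.
  move=> k0; have := @state_lower_bound g (k *: S) 0 x0 gst.
  rewrite linearZ complexReM k0 mul0r sub0r oppr_ge0; apply=> x _.
  by rewrite [X in rinner X _](_ : _ = k *: S x) // rinnerZl S_real k0; lra.
by have := iS 'i erefl; have := iS (- 'i) (oppr0 _); rewrite /=; lra.
Qed.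

Definition vector_functional x S : R[i] := inner (S x) x.

Lemma vector_functional_is_scalar x : scalar (vector_functional x).
Proof.
move=> k S T; rewrite /vector_functional.
rewrite [X in inner X _](_ : _ = k *: S x + T x) // linearDl.
by congr (_ + _); exact: innerZl.
Qed.

HB.instance Definition _ x :=
  GRing.isLinear.Build _ _ _ _ _ (vector_functional_is_scalar x).

(** Cauchy-Schwarz bounds the norm by 1, and the identity operator attains it. *)
Lemma vector_functional_is_state x :
  rnorm x = 1 -> is_state (vector_functional x : {scalar bop H}).
Proof.
move=> x1; have g1 : vector_functional x 1 = 1.
  by rewrite /vector_functional inner_norm -rnormE x1 expr1n.
split=> //; apply/eqP; rewrite eq_le; apply/andP; split.
  apply: ge_ereal_sup => _ [S /= S1 <-]; rewrite lee_fin.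
  rewrite (le_trans (rnorm_inner_le _ _)) // x1 mulr1.
  by rewrite (le_trans _ S1) // rnorm_le_opnorm // x1.
apply: ereal_sup_ubound; exists 1 => /=; first exact: opnorm_le.
by rewrite g1 /rnorm normr1.
Qed.

End States.

(** * Residuals along Af and the upper bound for states *)

Section TranslatableRadius.
Variables (R : realType) (H : hilbertType R).
Implicit Types (x y u v f : H) (T A : bop H).

(** Pythagoras for the projection on the line of [v]; it links the two usual formulas for the
    translatable radius. *)
Lemma sqr_rnorm_proj u v : v != 0 ->
  rnorm (u - (inner u v / inner v v) *: v) ^+ 2 =
  rnorm u ^+ 2 - (rinner u v ^+ 2 + iinner u v ^+ 2) / rnorm v ^+ 2.
Proof.
move=> v_neq0.
have n_neq0 : rnorm v != 0 by apply: contra_neq v_neq0; exact: rnorm_eq0.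
have -> : inner u v / inner v v =
    (rinner u v / rnorm v ^+ 2) +i* (iinner u v / rnorm v ^+ 2).
  rewrite inner_norm -rnormE -rmorphXn -fmorphV /= /rinner /iinner.
  case: (inner u v) => a b /=; apply/eqP; rewrite eq_complex /=.
  by apply/andP; split; apply/eqP; ring.
rewrite -rinnerxx !innerE /= !iinnerxx (iinnerC u v).
by rewrite (rinnerC u v) !rinnerxx; field.
Qed.

Lemma state_value_le T A (M c : R) (g : {scalar bop H}) :
  (exists x : H, rnorm x = 1) ->
  0 < c -> (forall x, c * rnorm x <= rnorm (A x)) ->
  (forall f, rnorm f = 1 ->
    rnorm (T f) ^+ 2 - (rinner (T f) (A f) ^+ 2 + iinner (T f) (A f) ^+ 2)
      / rnorm (A f) ^+ 2 <= M) ->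
  is_state g -> g (adjoint A * A) != 0 ->
  complex.Re (g (adjoint T * T)
    - `|g (adjoint A * T)| ^+ 2 / g (adjoint A * A)) <= M.
Proof.
move=> x0 c_gt0 A_ge T_le gst gAA_neq0.
have radj (U V : bop H) x : rinner ((adjoint U * V) x) x = rinner (V x) (U x).
  by rewrite /rinner inner_adjointM.
have iadj (U V : bop H) x : iinner ((adjoint U * V) x) x = iinner (V x) (U x).
  by rewrite /iinner inner_adjointM.
have ImAA : complex.Im (g (adjoint A * A)) = 0.
  by apply: state_real => // x; rewrite iadj iinnerxx.
pose a := complex.Re (g (adjoint A * A)).
have gAA : g (adjoint A * A) = a%:C.
  by rewrite /a; move: ImAA; case: (g _) => ? ? /= ->.
have a_gt0 : 0 < a.
  rewrite lt_def; apply/andP; split.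
    by apply: contra gAA_neq0; rewrite gAA => /eqP->.
  by apply: state_lower_bound => // x _; rewrite radj rinnerxx sqr_ge0.
pose z := g (adjoint A * T).
pose l1 := complex.Re z / a; pose l2 := complex.Im z / a.
have z1 : complex.Re z = l1 * a by rewrite divfK ?gt_eqF.
have z2 : complex.Im z = l2 * a by rewrite divfK ?gt_eqF.
pose tau := complex.Re (g (adjoint T * T)).
pose rho := tau - a * (l1 ^+ 2 + l2 ^+ 2).
have -> : complex.Re (g (adjoint T * T)
    - `|g (adjoint A * T)| ^+ 2 / g (adjoint A * A)) = rho.
  rewrite -/z gAA -rnormE -rmorphXn -fmorphV -rmorphM /= sqr_rnorm_complex z1 z2.
  rewrite /rho /tau; case: (g (adjoint T * T)) => t1 t2 /=.
  by field; rewrite gt_eqF.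
(* This multiple of A makes g(A^*T') = 0 and g(T'^*T') = [rho], so the target triple is (0, 0,
   rho). *)
pose T' := T - (l1 +i* l2) *: A.
have T'E x : T' x = T x - (l1 +i* l2) *: A x by [].
pose Q1 x := rinner (T' x) (A x); pose Q2 x := iinner (T' x) (A x).
pose Q3 x := rinner (T' x) (T' x).
have Q1E x : Q1 x = rinner (T x) (A x) - l1 * rnorm (A x) ^+ 2.
  by rewrite /Q1 T'E !innerE /= iinnerxx rinnerxx; ring.
have Q2E x : Q2 x = iinner (T x) (A x) - l2 * rnorm (A x) ^+ 2.
  by rewrite /Q2 T'E !innerE /= iinnerxx rinnerxx; ring.
have Q3E x : Q3 x = rnorm (T x) ^+ 2 + (l1 ^+ 2 + l2 ^+ 2) * rnorm (A x) ^+ 2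
    - 2 * (l1 * rinner (T x) (A x) + l2 * iinner (T x) (A x)).
  rewrite /Q3 T'E !innerE /= !iinnerxx.
  by rewrite (iinnerC (T x) (A x)) (rinnerC (T x) (A x)) !rinnerxx; ring.
have approx := @unit_vector_approx R H (fun x => rinner x x) Q1 Q2 Q3.
have [B1 B1_ge0 T'_le] := bop_bounded T'.
have [B2 B2_ge0 A_le] := bop_bounded A.
have {}approx e : 0 < e -> exists x, [/\ rnorm x = 1, `|Q1 x| <= e, `|Q2 x| <= e
    & rho - e <= Q3 x].
  have unit_sqr x : rinner x x = 1 -> rnorm x = 1.
    by rewrite rinnerxx => /eqP; rewrite sqrp_eq1 ?rnorm_ge0 // => /eqP.
  move=> e_gt0.
  have [] := approx (B1 * B2 + B1 ^+ 2) 0 0 rho _ _ _ _ _ _ _ _ _ e e_gt0.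
  - exact: (hermitian_quadratic_rinner 1 1).
  - exact: hermitian_quadratic_rinner.
  - exact: hermitian_quadratic_iinner.
  - exact: hermitian_quadratic_rinner.
  - by move=> x; rewrite rinnerxx sqr_ge0.
  - by move=> x /eqP; rewrite rinnerxx sqrf_eq0 => /eqP/rnorm_eq0.
  - by have [x x1] := x0; exists x; rewrite rinnerxx x1 expr1n.
  - move=> x /unit_sqr x1.
    have := T'_le x; have := A_le x; rewrite x1 !mulr1 => A1 T1.
    have TA : rnorm (T' x) * rnorm (A x) <= B1 * B2 by rewrite ler_pM ?rnorm_ge0.
    have TT : rnorm (T' x) * rnorm (T' x) <= B1 ^+ 2.
      by rewrite expr2 ler_pM ?rnorm_ge0.
    have B12 : 0 <= B1 * B2 by rewrite mulr_ge0.
    split; [apply: le_trans (ler_norm_rinner _ _) _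
      |apply: le_trans (ler_norm_iinner _ _) _
      |apply: le_trans (ler_norm_rinner _ _) _].
    + by rewrite (le_trans TA) // lerDl sqr_ge0.
    + by rewrite (le_trans TA) // lerDl sqr_ge0.
    + by rewrite (le_trans TT) // lerDr.
  - move=> a1 a2 a3 delta le_Q; rewrite !mulr0 !add0r.
    (* Coefficients of a1 Re(A^*T') + a2 Im(A^*T') + a3 T'^*T' expanded in T^*T, A^*T and A^*A. Only
       real parts matter, so each cross term and its adjoint are merged into [k1]. *)
    pose k1 := (a1 - 2 * a3 * l1) +i* (2 * a3 * l2 - a2).
    pose k2 := a3 * (l1 ^+ 2 + l2 ^+ 2) - (a1 * l1 + a2 * l2).
    pose S := a3%:C *: (adjoint T * T) +
      (k1 *: (adjoint A * T) + k2%:C *: (adjoint A * A)).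
    have -> : a3 * rho = complex.Re (g S).
      rewrite !linearD !linearZ /= !complexReM /= -/z z1 z2 gAA /= -/tau.
      by rewrite /rho /k2; ring.
    apply: state_lower_bound => // x x1.
    have := le_Q x; rewrite rinnerxx x1 expr1n => /(_ erefl)/le_trans; apply.
    rewrite [X in rinner X _](_ : _ = a3%:C *: (adjoint T * T) x
      + (k1 *: (adjoint A * T) x + k2%:C *: (adjoint A * A) x)) //.
    rewrite !innerE !radj !iadj /= !rinnerxx !iinnerxx Q1E Q2E Q3E /k2.
    by rewrite le_eqVlt; apply/orP; left; apply/eqP; ring.
  move=> x [/unit_sqr x1 q1 q2 q3]; exists x; split=> //.
  - by rewrite subr0 in q1.
  - by rewrite subr0 in q2.
apply/ler_addgt0Pr => e e_gt0.
(* The 1 pays for the loss in [Q3], and 2 / c^2 for the component of T'f along Af; [d <= 1] gives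
   d^2 <= d. *)
pose C := 1 + 2 / c ^+ 2.
have c2_gt0 : 0 < c ^+ 2 by rewrite exprn_gt0.
have C_gt0 : 0 < C by rewrite ltr_pwDl // divr_ge0 // ltW.
pose d := Num.min 1 (e / C).
have d_gt0 : 0 < d by rewrite lt_min ltr01 divr_gt0.
have d_le1 : d <= 1 by rewrite ge_min lexx.
have dC : d * C <= e by rewrite -ler_pdivlMr // ge_min lexx orbT.
have [f [f1 q1 q2 q3]] := approx d d_gt0.
have sq_le (y : R) : `|y| <= d -> y ^+ 2 <= d.
  move=> yd; rewrite -real_normK ?num_real // (le_trans (_ : _ <= d ^+ 2)) //.
    by rewrite ler_pXn2r ?nnegrE // ltW.
  by rewrite expr2 ler_piMl // ltW.
have Af : c ^+ 2 <= rnorm (A f) ^+ 2.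
  have := A_ge f; rewrite f1 mulr1 => le.
  by rewrite ler_pXn2r ?nnegrE ?rnorm_ge0 // ltW.
have Af_gt0 : 0 < rnorm (A f) ^+ 2 by rewrite (lt_le_trans c2_gt0).
(* T'f and Tf differ by a multiple of Af, so they have the same residual along Af; Pythagoras then
   gives the square of the norm of T'f. *)
have Q3_le : Q3 f <= M + (Q1 f ^+ 2 + Q2 f ^+ 2) / rnorm (A f) ^+ 2.
  rewrite -lerBlDr (le_trans _ (T_le f f1)) // le_eqVlt; apply/orP; left.
  rewrite Q1E Q2E Q3E; apply/eqP; field.
  by rewrite -sqrf_eq0 gt_eqF.
have : (Q1 f ^+ 2 + Q2 f ^+ 2) / rnorm (A f) ^+ 2 <= d * (2 / c ^+ 2).
  rewrite mulrA ler_pM ?addr_ge0 ?sqr_ge0 ?invr_ge0 ?sqr_ge0 //.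
    by have := sq_le _ q1; have := sq_le _ q2; lra.
  by rewrite lef_pV2 ?posrE.
by move: dC; rewrite /C; lra.
Qed.

End TranslatableRadius.

(** * Equality of the squared radius and the supremum over states *)

Theorem theorem4 (R : realType) (H : hilbertType R)
    (H_neq0 : exists x : H, x != 0) (T A : bop H)
    (A_ap : ~ approx_point_spectrum A 0) :
  translatable_radius T A ^+ 2 =
  sup [set complex.Re (g (adjoint T * T)
                       - `|g (adjoint A * T)| ^+ 2 / g (adjoint A * A))
      | g in [set g : {scalar bop H} | is_state g /\ g (adjoint A * A) != 0]].
Proof.
have x0 : exists x : H, rnorm x = 1.
  have [x x_neq0] := H_neq0; exists ((rnorm x)^-1%:C *: x).
  have x_gt0 : 0 < rnorm x.
    rewrite lt_def rnorm_ge0 andbT; apply: contra_neq x_neq0; exact: rnorm_eq0.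
  by rewrite rnormZ /rnorm ger0_norm ?ler0c ?invr_ge0 ?rnorm_ge0 //= mulVf ?gt_eqF.
have [c c_gt0 A_ge] : exists2 c : R, 0 < c & forall x, c * rnorm x <= rnorm (A x).
  apply: contrapT => no_c; apply: A_ap => -[c c_gt0 A_ge]; apply: no_c.
  by exists c => // x; have := A_ge x; rewrite scale0r subr0.
have Af_gt0 f : rnorm f = 1 -> 0 < rnorm (A f).
  by move=> f1; rewrite (lt_le_trans c_gt0) //; have := A_ge f; rewrite f1 mulr1.
have Af_neq0 f : rnorm f = 1 -> A f != 0.
  move=> /Af_gt0; apply: contraTneq => ->.
  by rewrite /rnorm normr0 ltxx.
set E := (X in sup X); pose M := translatable_radius T A.
pose q f := rnorm (T f - (inner (T f) (A f) / inner (A f) (A f)) *: A f).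
have qE f (f1 : rnorm f = 1) := sqr_rnorm_proj (T f) (Af_neq0 f f1).
(* A bound for [T] also bounds the residuals, so the real [sup] is a genuine supremum and not its
   default value. *)
have q_le f : rnorm f = 1 -> q f <= M.
  move=> f1; apply: ub_le_sup; last by exists f.
  have [K K_ge0 T_le] := bop_bounded T; exists K => _ [h /= h1 <-].
  rewrite -(@ler_pXn2r _ 2) ?nnegrE ?rnorm_ge0 // qE //.
  have Th : rnorm (T h) ^+ 2 <= K ^+ 2.
    by rewrite ler_pXn2r ?nnegrE ?rnorm_ge0 //; have := T_le h; rewrite h1 mulr1.
  by rewrite (le_trans _ Th) // gerBl divr_ge0 ?addr_ge0 ?sqr_ge0.
have E_le : ubound E (M ^+ 2).
  move=> _ [g /= [gst gAA] <-]; apply: (state_value_le x0 c_gt0 A_ge _ gst gAA).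
  move=> f f1; rewrite -qE // ler_pXn2r ?nnegrE ?rnorm_ge0 ?q_le //.
  by rewrite (le_trans _ (q_le f f1)) // rnorm_ge0.
have qE_in f : rnorm f = 1 -> E (q f ^+ 2).
  move=> f1; exists (vector_functional f : {scalar bop H}).
    split; first exact: vector_functional_is_state.
    rewrite /= /vector_functional inner_adjointM inner_norm expf_eq0 /=.
    by rewrite normr_eq0 Af_neq0.
  rewrite /= /vector_functional !inner_adjointM /q qE // !inner_norm -!rnormE.
  rewrite -!rmorphXn -fmorphV -rmorphM -rmorphB /=.
  by rewrite sqr_rnorm_complex.
have E_ub : has_ubound E by exists (M ^+ 2).
have [f0 f0_1] := x0.
apply/eqP; rewrite eq_le; apply/andP; split; last first.
  by apply: ge_sup => //; exists (q f0 ^+ 2); exact: qE_in.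
have q_le_sup f : rnorm f = 1 -> q f ^+ 2 <= sup E.
  by move=> f1; apply: ub_le_sup => //; exact: qE_in.
have sup_ge0 : 0 <= sup E by rewrite (le_trans _ (q_le_sup f0 f0_1)) ?sqr_ge0.
have M_ge0 : 0 <= M by rewrite (le_trans _ (q_le f0 f0_1)) ?rnorm_ge0.
(* The radius is a supremum of norms while [E] contains their squares; passing to the square root
   lets the bounds be compared termwise. *)
have : M <= Num.sqrt (sup E).
  apply: ge_sup; first by exists (q f0), f0.
  move=> _ [f /= f1 <-]; rewrite -(@ler_pXn2r _ 2) ?nnegrE ?rnorm_ge0 ?sqrtr_ge0 //.
  by rewrite sqr_sqrtr // q_le_sup.
by rewrite -(@ler_pXn2r _ 2) ?nnegrE ?sqrtr_ge0 // sqr_sqrtr.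
Qed.
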